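(* Let $K$ be a field and let $\Delta$ be a shellable simplicial complex on the vertex set $[n]$ with shelling $F_1,\ldots,F_r$ and shelling numbers $a_1,\ldots,a_r$. Let $S=K[x_1,\ldots,x_n]$. Then $(0)=M_0\subset M_1\subset\cdots\subset M_{r-1}\subset M_r=K[\Delta]=S/I_\Delta$ with $$M_i=\Big(\bigcap_{j=1}^{r-i}P_{F_j}\Big)\Big/I_\Delta\quad\text{and}\quad M_i/M_{i-1}\cong S/P_{F_{r-i+1}}(-a_{r-i+1})$$ (isomorphisms of graded $S$-modules) is a clean filtration of $S/I_\Delta$.
   Context: $I_\Delta$ is the Stanley-Reisner ideal, generated by all squarefree monomials $x_{i_1}\cdots x_{i_k}$ with $\{i_1,\dots,i_k\}\notin\Delta$, and $K[\Delta]=S/I_\Delta$. For a face $F$, $P_F=(x_j: j\notin F)$; thus $I_\Delta=\bigcap_{i=1}^r P_{F_i}$ when $F_1,\dots,F_r$ are the facets. The empty intersection of ideals is $S$. $\langle G_1,\dots,G_k\rangle$ denotes the smallest subcomplex of $\Delta$ containing the faces $G_1,\dots,G_k$. A shelling (non-pure in general) of $\Delta$ is an order $F_1,\dots,F_r$ of all facets of $\Delta$ such that for $i=2,\dots,r$ all facets of $\langle F_1,\dots,F_{i-1}\rangle\cap\langle F_i\rangle$ are maximal proper faces of $\langle F_i\rangle$ (i.e. of the form $F_i\setminus\{v\}$). The shelling numbers are $a_1=0$ and, for $i\ge2$, $a_i=$ the number of facets of $\langle F_1,\dots,F_{i-1}\rangle\cap\langle F_i\rangle$. A clean filtration of a finitely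 generated $S$-module $M$ is a filtration $0=M_0\subset\cdots\subset M_r=M$ with $M_i/M_{i-1}\cong S/P_i$, $P_i$ a minimal prime of $\operatorname{Supp}(M)$ for all $i$. *)

(* Defs.v *)
From HB Require Import structures.
From mathcomp Require Import all_boot all_order all_algebra ring_quotient.
From mathcomp Require Import boolp.
From mathcomp Require Export mpoly.

Set Implicit Arguments.
Unset Strict Implicit.
Unset Printing Implicit Defensive.

Import GRing.Theory.

Local Open Scope ring_scope.
Local Open Scope quotient_scope.

(* Ideals of a ring R are submodules of the regular module R^o.               *)

Section Submodules.
Variables (R : comNzRingType) (V : lmodType R).

Definition submod (U : submodClosed V) := {x : V | x \in U}.

HB.instance Definition _ (U : submodClosed V) := SubChoice.on (submod U).
HB.instance Definition _ (U : submodClosed V) :=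
  [SubChoice_isSubLmodule of submod U by <:].

(* A [submodClosed] predicate of an lmodType is closed under opposite, but    *)
(* ssralg does not make it [zmodClosed], which [Quotient.quot] expects.       *)
Definition zmod_of (U : submodClosed V) : {pred V} := U.

Lemma zmod_of_closed U : zmod_closed (zmod_of U).
Proof. exact: GRing.submod_closedB (submodClosedP U). Qed.

HB.instance Definition _ U :=
  GRing.isZmodClosed.Build V (zmod_of U) (zmod_of_closed U).

Definition lquot (U : submodClosed V) := Quotient.quot (zmod_of U).

Section LmodQuotient.
Variable U : submodClosed V.
Local Notation Q := (lquot U).

HB.instance Definition _ := GRing.Zmodule.on Q.
HB.instance Definition _ := EqQuotient.on Q.

Definition lproj (x : V) : Q := \pi_Q x.

Definition lquot_scale (a : R) (x : Q) : Q := lproj (a *: repr x).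

Lemma lproj_eq x y : (lproj x == lproj y) = (x - y \in U).
Proof. by rewrite -[RHS]/(x - y \in zmod_of U) Quotient.idealrBE. Qed.

Lemma lprojD x y : lproj (x + y) = lproj x + lproj y.
Proof. exact: Quotient.pi_add. Qed.

Lemma lquot_scaleE a x : lquot_scale a (lproj x) = lproj (a *: x).
Proof.
apply/eqP; rewrite lproj_eq -scalerBr rpredZ //.
by rewrite -lproj_eq; apply/eqP; exact: reprK.
Qed.

Lemma lproj_surj x : exists y, x = lproj y.
Proof. by exists (repr x); rewrite /lproj reprK. Qed.

Lemma lquot_scalerA a b x : lquot_scale a (lquot_scale b x) = lquot_scale (a * b) x.
Proof. by case: (lproj_surj x) => y ->; rewrite !lquot_scaleE scalerA. Qed.

Lemma lquot_scale1r : left_id 1 lquot_scale.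
Proof. by move=> x; case: (lproj_surj x) => y ->; rewrite lquot_scaleE scale1r. Qed.

Lemma lquot_scalerDr : right_distributive lquot_scale +%R.
Proof.
move=> a x y; case: (lproj_surj x) => x' ->; case: (lproj_surj y) => y' ->.
by rewrite -lprojD !lquot_scaleE scalerDr lprojD.
Qed.

Lemma lquot_scalerDl x : {morph lquot_scale^~ x : a b / a + b}.
Proof.
by move=> a b; case: (lproj_surj x) => y ->; rewrite !lquot_scaleE scalerDl lprojD.
Qed.

HB.instance Definition _ := GRing.Zmodule_isLmodule.Build R Q
  lquot_scalerA lquot_scale1r lquot_scalerDr lquot_scalerDl.

Lemma lprojZ : scalable lproj.
Proof. by move=> a x; rewrite -lquot_scaleE. Qed.

Lemma lproj_is_linear : linear lproj.
Proof. by move=> a x y; rewrite lprojD lprojZ. Qed.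

HB.instance Definition _ := GRing.isLinear.Build R V Q _ lproj lproj_is_linear.

(* The image J / U in V / U of a submodule J of V. *)
Definition quot_submod (J : submodClosed V) : {pred Q} :=
  fun x => `[< exists2 y, y \in J & x = lproj y >].

Lemma quot_submod_closed J : submod_closed (quot_submod J).
Proof.
split=> [|a x y]; first by apply/asboolP; exists 0; rewrite ?rpred0 ?linear0.
move=> /asboolP [x' Jx ->] /asboolP [y' Jy ->]; apply/asboolP.
by exists (a *: x' + y'); rewrite ?rpredD ?rpredZ ?linearP.
Qed.

HB.instance Definition _ J :=
  GRing.isSubmodClosed.Build R Q (quot_submod J) (quot_submod_closed J).

End LmodQuotient.

Definition restr_submod (U W : submodClosed V) : {pred submod U} :=
  fun x => val x \in W.
Arguments restr_submod U W : clear implicits.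

Lemma in_restr_submod U W x : (x \in restr_submod U W) = (val x \in W).
Proof. by []. Qed.

Lemma restr_submod_closed U W : submod_closed (restr_submod U W).
Proof.
split=> [|a x y]; first by rewrite in_restr_submod raddf0 rpred0.
by rewrite !in_restr_submod => Wx Wy; rewrite linearP rpredD ?rpredZ.
Qed.

HB.instance Definition _ U W := GRing.isSubmodClosed.Build R (submod U)
  (restr_submod U W) (restr_submod_closed U W).

Definition seq_cap (T : Type) (P : T -> submodClosed V) (s : seq T) :
  {pred V} := fun x => all (fun t => x \in P t) s.

Lemma in_seq_cap T (P : T -> submodClosed V) s x :
  (x \in seq_cap P s) = all (fun t => x \in P t) s.
Proof. by []. Qed.

Lemma seq_cap_closed T (P : T -> submodClosed V) s :
  submod_closed (seq_cap P s).
Proof.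
split=> [|a x y]; rewrite !in_seq_cap.
  by elim: s => //= t s ->; rewrite rpred0.
elim: s => //= t s IHs /andP[xt /IHs{}IHs] /andP[yt /IHs ->].
by rewrite rpredD ?rpredZ.
Qed.

HB.instance Definition _ T P s :=
  GRing.isSubmodClosed.Build R V (@seq_cap T P s) (@seq_cap_closed T P s).

End Submodules.

Arguments quot_submod {R V} U J _.
Arguments restr_submod {R V} U W _.

(* U / W, for W a submodule of U *)
Definition subquot (R : comNzRingType) (V : lmodType R)
  (U W : submodClosed V) : lmodType R := lquot (restr_submod U W).

Section Ideals.
Variable R : comNzRingType.

Definition ideal_gen (gs : seq R) : {pred R^o} :=
  fun f => `[< exists c : R -> R, f = \sum_(g <- gs) c g * g >].

Lemma ideal_gen_closed gs : submod_closed (ideal_gen gs).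
Proof.
split=> [|a x y].
  by apply/asboolP; exists (fun=> 0); rewrite big1 // => g _; rewrite mul0r.
move=> /asboolP [c ->] /asboolP [d ->]; apply/asboolP.
exists (fun g => a * c g + d g); rewrite scaler_sumr -big_split /=.
by apply: eq_bigr => g _; rewrite mulrDl -mulrA.
Qed.

HB.instance Definition _ gs :=
  GRing.isSubmodClosed.Build R R^o (ideal_gen gs) (ideal_gen_closed gs).

Definition prime_ideal (P : submodClosed R^o) :=
  (1 : R) \notin P /\ prime_idealr_closed (P : {pred R}).

Section Support.
Variable M : lmodType R.

(* Equality of the fractions m / s and m' / s' in the localization M_P, whose *)
(* elements are the m / s with m in M and s outside P.                        *)
Definition eq_frac (P : submodClosed R^o) (m : M) (s : R) (m' : M) (s' : R) :=
  exists2 u : R, u \notin P & u *: (s' *: m - s *: m') = 0.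

(* Supp(M): the primes P such that M_P is nonzero. *)
Definition in_supp (P : submodClosed R^o) :=
  prime_ideal P /\
  exists (m : M) (s : R), s \notin P /\ ~ eq_frac P m s 0 1.

Definition min_prime_supp (P : submodClosed R^o) :=
  in_supp P /\
  forall P' : submodClosed R^o, in_supp P' -> {subset P' <= P} -> P' =i P.

End Support.

Definition lmod_isomorphic (M N : lmodType R) :=
  exists phi : {linear M -> N}, bijective phi.

(* Only the values Ms 0, ..., Ms r are used. *)
Definition clean_filtration (M : lmodType R) (r : nat)
    (Ms : nat -> submodClosed M) :=
  [/\ Ms 0%N =i pred1 0,
      Ms r =i predT,
      forall i, (0 < i <= r)%N -> {subset Ms i.-1 <= Ms i}
    & forall i, (0 < i <= r)%N -> exists2 P : submodClosed R^o,
        min_prime_supp M P & lmod_isomorphic (subquot (Ms i) (Ms i.-1)) (lquot P)].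

End Ideals.

Section Graded.
Variables (K : fieldType) (n : nat).
Local Notation S := {mpoly K[n]}.

(* A Z-grading of an S-module M is given by its homogeneous components        *)
(* d |-> M_d; [is_grading] says that these make M a graded S-module.          *)
Definition components (M : lmodType S) := int -> M -> Prop.

Definition ring_components : components S^o := fun d f =>
  match d with
  | Posz k => (f : S) \is k.-homog
  | Negz _ => f = 0
  end.

Record is_grading (M : lmodType S) (gM : components M) : Prop := IsGrading {
  grading0 : forall d, gM d 0;
  gradingB : forall d x y, gM d x -> gM d y -> gM d (x - y);
  gradingZ : forall d e (f : S) x,
    ring_components d f -> gM e x -> gM (d + e) (f *: x);
  grading_sum : forall x, exists (ds : seq int) (h : int -> M),
    [/\ uniq ds, forall d, gM d (h d) & x = \sum_(d <- ds) h d];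
  grading_direct : forall (ds : seq int) (h : int -> M), uniq ds ->
    (forall d, gM d (h d)) -> \sum_(d <- ds) h d = 0 ->
    forall d, d \in ds -> h d = 0
}.

Definition quot_components (M : lmodType S) (gM : components M)
    (U : submodClosed M) : components (lquot U) :=
  fun d x => exists2 y, gM d y & x = lproj U y.
Arguments quot_components [M] gM U _ _.

Definition submod_components (M : lmodType S) (gM : components M)
    (U : submodClosed M) : components (submod U) :=
  fun d x => gM d (val x).
Arguments submod_components [M] gM U _ _.

Definition subquot_components (M : lmodType S) (gM : components M)
    (U W : submodClosed M) : components (subquot U W) :=
  quot_components (submod_components gM U) (restr_submod U W).

(* M(a), with M(a)_d = M_(a + d) *)
Definition twist (M : lmodType S) (gM : components M) (a : int) :
  components M := fun d => gM (a + d).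

Definition graded_isomorphic (M N : lmodType S)
    (gM : components M) (gN : components N) :=
  [/\ is_grading gM, is_grading gN
    & exists phi : {linear M -> N},
        bijective phi /\ forall d x, gM d x <-> gN d (phi x)].

End Graded.

Arguments ring_components K n _ _ : clear implicits.
Arguments quot_components {K n M} gM U _ _.
Arguments submod_components {K n M} gM U _ _.
Arguments subquot_components {K n M} gM U W _ _.

Section SimplicialComplexes.
Variable n : nat.
Implicit Types (A F G : {set 'I_n}) (D Delta : {set {set 'I_n}}).

(* Neither that {i} is a face for each i, nor that Delta is nonempty, is      *)
(* required.                                                                  *)
Definition simplicial_complex Delta :=
  [forall F in Delta, forall A : {set 'I_n}, (A \subset F) ==> (A \in Delta)].

Definition facets Delta : {set {set 'I_n}} :=
  [set F in Delta | [forall G in Delta, (F \subset G) ==> (F == G)]].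

Definition subcomplex_gen Delta (Gs : seq {set 'I_n}) : {set {set 'I_n}} :=
  \bigcap_(D : {set {set 'I_n}} | [&& simplicial_complex D, D \subset Delta
                                    & all (fun G => G \in D) Gs]) D.

(* F_i is indexed from 1. *)
Definition nth_facet (Fs : seq {set 'I_n}) (i : nat) := nth set0 Fs i.-1.

(* <F_1, ..., F_(i-1)> :&: <F_i> *)
Definition shelling_meet Delta Fs i : {set {set 'I_n}} :=
  subcomplex_gen Delta (take i.-1 Fs)
    :&: subcomplex_gen Delta [:: nth_facet Fs i].

Definition is_shelling Delta (Fs : seq {set 'I_n}) :=
  [/\ uniq Fs,
      Fs =i facets Delta
    & forall i, (2 <= i <= size Fs)%N ->
      forall A, A \in facets (shelling_meet Delta Fs i) ->
      exists2 v, v \in nth_facet Fs i & A = nth_facet Fs i :\ v].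

Definition shelling_number Delta Fs (i : nat) : nat :=
  if (i <= 1)%N then 0%N else #|facets (shelling_meet Delta Fs i)|.

Variable K : fieldType.

Definition SR_ideal Delta : submodClosed {mpoly K[n]}^o :=
  ideal_gen [seq \prod_(i in A) 'X_i | A : {set 'I_n} <- enum (~: Delta)].

Definition face_ideal F : submodClosed {mpoly K[n]}^o :=
  ideal_gen [seq 'X_j | j <- enum (~: F)].

Definition SR_module Delta : lmodType {mpoly K[n]} := lquot (SR_ideal Delta).

(* M_i = (P_(F_1) :&: ... :&: P_(F_(r - i))) / I_Delta *)
Definition SR_filtration Delta (Fs : seq {set 'I_n}) (i : nat) :
    submodClosed (SR_module Delta) :=
  quot_submod (SR_ideal Delta) (seq_cap face_ideal (take (size Fs - i) Fs)).

End SimplicialComplexes.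

(* Main.v *)
From HB Require Import structures.
Require Import Defs.
From mathcomp Require Import all_boot all_order all_algebra.
From mathcomp Require Import boolp.

(* Membership in each of the ideals involved depends only on the supports     *)
(* (sets of variables) of the monomials of f: f is in P_F when none of them   *)
(* is contained in F, and in I_Delta when none of them is a face; whence      *)
(* I_Delta is the intersection of the P_F over the facets.                    *)
(* Let J be the intersection of P_(F_j) for j < k, and R the set of v in F_k  *)
(* such that F_k \ v lies in an earlier facet. No earlier facet contains R,   *)
(* so x_R is in J; and a monomial of J supported on F_k is divisible by x_R.  *)
(* Hence J + P_(F_k) = (x_R) + P_(F_k), and multiplication by x_R induces an  *)
(* isomorphism S / P_(F_k) (-#|R|) -> J / (J cap P_(F_k)). The facets of the  *)
(* intersection of <F_k> with the earlier facets are the F_k \ v for v in R,  *)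
(* so #|R| = a_k.                                                             *)

(** For k = r - i + 1, M_i is cut out by the first k - 1 facets and M_(i-1) by the first k, so M_i /
    M_(i-1) is J / (J cap P_(F_k)). [facet_graded_isomorphic] identifies this quotient from two
    facts: x_R lies in J ([facet_restriction_not_sub], where the shelling enters through
    [facets_shelling_meet]), and every monomial of J supported on F_k is divisible by x_R. The shift
    is a_k by [card_facet_restriction]. Cleanness also needs each P_(F_k) to be a minimal prime of
    the support ([facet_min_prime_supp]). At the ends, the intersection over all facets is I_Delta
    and the empty one is S. *)

Set Implicit Arguments.
Unset Strict Implicit.
Unset Printing Implicit Defensive.

Import GRing.Theory.
Local Open Scope ring_scope.

(** * Quotient modules and the first isomorphism theorem *)

Section Submodules.
Variables (R : comNzRingType) (V : lmodType R).
Implicit Types U W J : submodClosed V.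

Lemma lproj_eq0 U x : (lproj U x == 0) = (x \in U).
Proof. by rewrite -(linear0 (lproj U)) lproj_eq subr0. Qed.

Lemma mem_quot_submod U J x :
  {subset U <= J} -> (lproj U x \in quot_submod U J) = (x \in J).
Proof.
move=> sUJ; apply/asboolP/idP => [[y Jy /eqP]|Jx]; last by exists x.
by rewrite lproj_eq => /sUJ Jxy; rewrite -(subrK y x) rpredD.
Qed.

(** First isomorphism theorem, for g surjective with kernel U, with the isomorphism directed from
    the image to the quotient, as the filtration requires. It sends y to the class of a chosen
    preimage; two preimages differ by an element of U. *)
Lemma lquot_lift (W : lmodType R) U (g : {linear V -> W}) :
  (forall x, (g x == 0) = (x \in U)) -> (forall y, exists x, g x = y) ->
  exists phi : {linear W -> lquot U},
    bijective phi /\ forall x, phi (g x) = lproj U x.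
Proof.
move=> kerg /choice [h gh].
have phig x : lproj U (h (g x)) = lproj U x.
  by apply/eqP; rewrite lproj_eq -kerg linearB /= gh subrr.
have phi_lin : linear (lproj U \o h).
  by move=> c x y /=; rewrite -{1}[x]gh -{1}[y]gh -linearP phig linearP.
pose phiL := GRing.isLinear.Build R W (lquot U) _ (lproj U \o h) phi_lin.
pose phi : {linear W -> lquot U} := HB.pack (lproj U \o h) phiL.
exists phi; split=> //.
exists (fun q => g (repr q)) => [y | q] /=.
  apply/eqP; rewrite -subr_eq0 -[X in _ - X]gh -linearB kerg.
  by rewrite -lproj_eq; apply/eqP; rewrite -[RHS]generic_quotient.reprK.
by rewrite phig -[RHS]generic_quotient.reprK.
Qed.

End Submodules.

(** * Gradings of quotients, submodules and twists *)

Section Graded.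
Variables (K : fieldType) (n : nat).
Local Notation S := {mpoly K[n]}.

(** Homogeneity of U, phrased through arbitrary finite decompositions so that no projection onto a
    component has to be named. *)
Definition homog_submod (M : lmodType S) (gM : components M)
    (U : submodClosed M) :=
  forall (ds : seq int) (h : int -> M), uniq ds -> (forall d, gM d (h d)) ->
    \sum_(d <- ds) h d \in U -> forall d, d \in ds -> h d \in U.

Section Homogeneous.
Variables (M : lmodType S) (gM : components M) (gradM : is_grading gM).
Implicit Types U W J : submodClosed M.

(** Homogeneity gives directness: a relation between classes lifts to a sum lying in U, whose terms
    then lie in U. *)
Lemma quot_grading U : homog_submod gM U -> is_grading (quot_components gM U).
Proof.
case: gradM => gM0 gMB gMZ gMsum _ homU; split.
- by move=> d; exists 0; rewrite ?linear0.
- move=> d _ _ [x dx ->] [y dy ->].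
  by exists (x - y); rewrite ?linearB //; apply: gMB.
- move=> d e f _ df [x ex ->].
  by exists (f *: x); rewrite ?linearZ //; apply: gMZ.
- move=> q; have [x ->] := lproj_surj q.
  have [ds [h [uds dh ->]]] := gMsum x.
  exists ds, (fun d => lproj U (h d)); split=> //; last exact: linear_sum.
  by move=> d; exists (h d).
- move=> ds h uds dh.
  have /choice [h' h'P] d : exists y, gM d y /\ h d = lproj U y.
    by case: (dh d) => y; exists y.
  rewrite (eq_bigr (fun d => lproj U (h' d))) => [|d _]; last by case: (h'P d).
  move=> /eqP; rewrite -linear_sum lproj_eq0 => Uh d dsd.
  have [_ ->] := h'P d; apply/eqP; rewrite lproj_eq0.
  by apply: homU Uh d dsd => // e; case: (h'P e).
Qed.

(** Homogeneity gives the decomposition: the components of an element of U stay in U. *)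
Lemma submod_grading U :
  homog_submod gM U -> is_grading (submod_components gM U).
Proof.
case: gradM => gM0 gMB gMZ gMsum gMdir homU; split; rewrite /submod_components.
- by move=> d; rewrite raddf0.
- by move=> d x y dx dy; rewrite raddfB; apply: gMB.
- by move=> d e f x df ex; rewrite linearZ; apply: gMZ.
- move=> x; have [ds [h [uds dh def_x]]] := gMsum (val x).
  (* Off [ds] nothing puts [h d] in U, so it is replaced by 0. *)
  have Uh d : (if d \in ds then h d else 0) \in U.
    case: ifP => [dsd|_]; last exact: rpred0.
    by apply: (homU ds h) => //; rewrite -def_x; apply: (valP x).
  exists ds, (fun d => Sub (if d \in ds then h d else 0) (Uh d) : submod U).
  split=> //= [d|]; first by case: ifP.
  apply: val_inj; rewrite raddf_sum def_x.
  by apply: eq_big_seq => d /= dsd; rewrite dsd.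
- move=> ds h uds dh h0 d dsd; apply: val_inj; rewrite raddf0.
  apply: (gMdir ds (val \o h)) => //.
  by rewrite -(raddf_sum val) h0 raddf0.
Qed.

Lemma homog_quot_submod U J : {subset U <= J} ->
  homog_submod gM J -> homog_submod (quot_components gM U) (quot_submod U J).
Proof.
move=> sUJ homJ ds h uds dh.
have /choice [h' h'P] d : exists y, gM d y /\ h d = lproj U y.
  by case: (dh d) => y; exists y.
rewrite (eq_bigr (fun d => lproj U (h' d))) => [|d _]; last by case: (h'P d).
rewrite -linear_sum mem_quot_submod // => Jh d dsd.
have [_ ->] := h'P d; rewrite mem_quot_submod //.
by apply: homJ Jh d dsd => // e; case: (h'P e).
Qed.

Lemma homog_restr_submod U W :
  homog_submod gM W -> homog_submod (submod_components gM U) (restr_submod U W).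
Proof.
move=> homW ds h uds dh; rewrite in_restr_submod raddf_sum => Wh d dsd.
by rewrite in_restr_submod; apply: (homW ds (val \o h)).
Qed.

Lemma twist_grading a : is_grading (twist gM a).
Proof.
case: gradM => gM0 gMB gMZ gMsum gMdir; split; rewrite /twist.
- by move=> d.
- by move=> d; apply: gMB.
- by move=> d e f x df ex; rewrite addrCA; apply: gMZ.
- move=> x; have [ds [h [uds dh ->]]] := gMsum x.
  exists [seq d - a | d <- ds], (fun d => h (a + d)); split=> //.
    by rewrite map_inj_uniq //; apply: addIr.
  by rewrite big_map; apply: eq_bigr => d _; rewrite subrKC.
- move=> ds h uds dh h0 d dsd.
  have := gMdir [seq a + e | e <- ds] (fun e => h (e - a)).
  rewrite map_inj_uniq; last exact: addrI.
  rewrite big_map (eq_bigr h) => [|e _]; last by rewrite addrC addKr.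
  move=> /(_ uds) /(_ _ h0 (a + d)); rewrite [a + d - a]addrC addKr; apply.
    by move=> e; have := dh (e - a); rewrite subrKC.
  exact: map_f.
Qed.

End Homogeneous.

Lemma subquot_grading (M : lmodType S) (gM : components M)
    (U W : submodClosed M) :
  is_grading gM -> homog_submod gM U -> homog_submod gM W ->
  is_grading (subquot_components gM U W).
Proof.
move=> gradM homU homW; apply: quot_grading; first exact: submod_grading.
exact: homog_restr_submod.
Qed.

(** Uniform in the sign of d: no monomial has negative degree, so for d < 0 the support must be
    empty. *)
Lemma ring_componentsP d (f : S) :
  ring_components K n d f <-> forall m, m \in msupp f -> (mdeg m)%:Z = d.
Proof.
case: d => d /=; first split.
- by move=> /dhomogP df m /df /= ->.
- by move=> df; apply/dhomogP => m /df [].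
split=> [-> m|df]; first by rewrite msupp0.
apply/eqP; rewrite -msupp_eq0; case: (msupp f) df => // m s.
by move/(_ m (mem_head _ _)).
Qed.

Lemma mcoeff_sum_components (ds : seq int) (h : int -> S) d m : uniq ds ->
  (forall d, ring_components K n d (h d)) -> d \in ds -> m \in msupp (h d) ->
  (\sum_(d <- ds) h d)@_m = (h d)@_m.
Proof.
move=> uds dh dsd dm; rewrite raddf_sum (bigD1_seq d) //=.
rewrite big1 ?addr0 // => e ed.
apply/eqP; rewrite mcoeff_eq0; apply: contra ed => em.
have /ring_componentsP/(_ m em) <- := dh e.
by have /ring_componentsP/(_ m dm) <- := dh d.
Qed.

Lemma ring_grading : is_grading (ring_components K n).
Proof.
split.
- by move=> d; apply/ring_componentsP => m; rewrite msupp0.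
- move=> d x y /ring_componentsP dx /ring_componentsP dy.
  apply/ring_componentsP => m /msuppB_le; rewrite mem_cat => /orP[/dx|/dy] //.
- move=> d e f x /ring_componentsP df /ring_componentsP ex.
  apply/ring_componentsP => m.
  move=> /msuppM_le /allpairsP [[p q] /= [/df <- /ex <- ->]].
  by rewrite mdegD PoszD.
- move=> f; exists [seq k%:Z | k <- iota 0 (msize f)].
  exists (fun d => if d is Posz k then pihomog mdeg k f else 0); split.
  + by rewrite map_inj_uniq ?iota_uniq // => i j [].
  + by case=> k //=; apply: pihomogP.
  rewrite big_map; have := @pihomog_partitionE _ _ mdeg (msize f) f (leqnn _).
  by rewrite -(big_mkord xpredT (fun i => pihomog mdeg i f)) /index_iota subn0.
- move=> ds h uds dh h0 d dsd; apply/eqP; rewrite -msupp_eq0.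
  case E: (msupp _) => [//|m s].
  have dm : m \in msupp (h d) by rewrite E mem_head.
  have := mcoeff_sum_components uds dh dsd dm.
  by rewrite h0 mcoeff0 => /esym/eqP; rewrite mcoeff_eq0 dm.
Qed.

(** Components of distinct degrees share no monomial, so nothing cancels and every monomial of [h d]
    survives in the sum. *)
Lemma homog_monomial_ideal (U : submodClosed S^o) (p : pred 'X_{1..n}) :
  (forall f : S, (f \in U) = all p (msupp f)) ->
  homog_submod (ring_components K n) U.
Proof.
move=> inU ds h uds dh; rewrite !inU => /allP sp d dsd; rewrite inU.
apply/allP => m dm; apply: sp.
by rewrite mcoeff_msupp (mcoeff_sum_components uds dh dsd dm) -mcoeff_msupp.
Qed.

End Graded.

(* Without uniqueness, the coefficient of a repeated generator is multiplied  *)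
(* by its multiplicity, which may vanish in R.                                *)
Lemma mem_ideal_gen (R : comNzRingType) (gs : seq R) g :
  uniq gs -> g \in gs -> g \in ideal_gen gs.
Proof.
move=> ugs gsg; apply/asboolP; exists (fun h => (h == g)%:R).
rewrite (bigD1_seq g) //= eqxx mul1r big1 ?addr0 // => h /negPf ->.
exact: mul0r.
Qed.

(** * Membership in monomial ideals, and the primes P_F *)

Section MonomialIdeals.
Variables (K : fieldType) (n : nat).
Local Notation S := {mpoly K[n]}.
Implicit Types (A F G : {set 'I_n}) (m : 'X_{1..n}) (f g : S).
Implicit Types (Delta : {set {set 'I_n}}).

Definition mnm_set A : 'X_{1..n} := [multinom (i \in A) : nat | i < n].

Definition mnm_supp m : {set 'I_n} := [set i | m i != 0%N].

Lemma in_mnm_supp m i : (i \in mnm_supp m) = (0 < m i)%N.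
Proof. by rewrite inE lt0n. Qed.

Lemma mdeg_mnm_set A : mdeg (mnm_set A) = #|A|.
Proof.
by rewrite mdegE -sum1_card [RHS]big_mkcond; apply: eq_bigr => i _;
   rewrite mnmE.
Qed.

Lemma mnm_supp_set A : mnm_supp (mnm_set A) = A.
Proof. by apply/setP => i; rewrite inE mnmE eqb0 negbK. Qed.

Lemma mnm_suppD m1 m2 : mnm_supp (m1 + m2)%MM = mnm_supp m1 :|: mnm_supp m2.
Proof. by apply/setP => i; rewrite !inE mnmDE addn_eq0 negb_and. Qed.

Lemma mnm_set_le A m : (mnm_set A <= m)%MM = (A \subset mnm_supp m).
Proof.
apply/mnm_lepP/subsetP => [le_Am i Ai|sAm i].
  by have := le_Am i; rewrite mnmE Ai in_mnm_supp.
by rewrite mnmE; case: (boolP (i \in A)) => // /sAm; rewrite in_mnm_supp.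
Qed.

Lemma prod_mpolyX A : \prod_(i in A) 'X_i = 'X_[mnm_set A] :> S.
Proof.
rewrite [RHS]mpolyXE_id [LHS]big_mkcond; apply: eq_bigr => i _.
by rewrite mnmE; case: (i \in A); rewrite ?expr1 ?expr0.
Qed.

Lemma mpolyX_inj : injective (fun m => 'X_[m] : S).
Proof.
move=> m m' /= eqX; apply/eqP.
have := mcoeffX K m m'; rewrite eqX mcoeffX eqxx => /esym/eqP.
by case: (m == m') => //; rewrite eq_sym oner_eq0.
Qed.

Lemma mnm_set_inj : injective mnm_set.
Proof. by move=> A B eqAB; rewrite -(mnm_supp_set A) eqAB mnm_supp_set. Qed.

(** A monomial ideal contains f when each monomial of f is divisible by some generator, and x_A
    divides x^m exactly when A is contained in the support of m. *)
Lemma in_sqfree_ideal (As : seq {set 'I_n}) f : uniq As ->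
  (f \in ideal_gen [seq 'X_[mnm_set A] : S | A <- As]) =
  all (fun m => has (fun A => A \subset mnm_supp m) As) (msupp f).
Proof.
move=> uAs; have uXs : uniq [seq 'X_[mnm_set A] : S | A <- As].
  by rewrite map_inj_uniq // => A B /mpolyX_inj/mnm_set_inj.
apply/idP/allP => [/asboolP [c ->] m | fAs].
  rewrite big_map => /msupp_sum_le/flattenP [_ /mapP [A AsA ->]].
  rewrite mem_filter /= in AsA.
  rewrite (perm_mem (msuppMX _ _)) => /mapP [m' _ ->].
  apply/hasP; exists A => //.
  by rewrite mnm_suppD mnm_supp_set subsetUl.
rewrite [f]mpolyE big_seq; apply: rpred_sum => m /fAs /hasP [A AsA].
rewrite -mnm_set_le => /submK <-; rewrite mpolyXD scalerAl.
by apply: (rpredZ (_ *: _ : S)); apply: mem_ideal_gen => //; apply: map_f.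
Qed.

Lemma in_face_ideal F f :
  (f \in face_ideal K F) = all (fun m => ~~ (mnm_supp m \subset F)) (msupp f).
Proof.
have eqX (j : 'I_n) : 'X_j = 'X_[mnm_set [set j]] :> S.
  by congr 'X_[_]; apply/mnmP => i; rewrite mnm1E mnmE inE eq_sym.
rewrite /face_ideal (eq_map eqX) (map_comp (fun A => 'X_[mnm_set A])).
rewrite in_sqfree_ideal ?(map_inj_uniq set1_inj) ?enum_uniq //.
apply: eq_all => m /=; apply/hasP/subsetPn => [[_ /mapP[j Fj ->]]|[j mj Fj]].
  by rewrite sub1set => mj; exists j; rewrite // mem_enum inE in Fj.
by exists [set j]; rewrite ?sub1set //; apply: map_f; rewrite mem_enum inE.
Qed.

(** As Delta is closed under subsets, a support contains a nonface exactly when it is itself a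
    nonface. *)
Lemma in_SR_ideal Delta f : simplicial_complex Delta ->
  (f \in SR_ideal K Delta) = all (fun m => mnm_supp m \notin Delta) (msupp f).
Proof.
move=> /'forall_implyP simD.
rewrite /SR_ideal (eq_map prod_mpolyX) in_sqfree_ideal ?enum_uniq //.
apply: eq_all => m /=; apply/hasP/idP => [[A]|Dm].
  rewrite mem_enum inE => DA sAm; apply: contra DA => Dm.
  by have /forallP/(_ A) := simD _ Dm; rewrite sAm.
by exists (mnm_supp m); rewrite // mem_enum inE.
Qed.

Lemma in_cap_face_ideal (Fs : seq {set 'I_n}) f :
  (f \in seq_cap (face_ideal K) Fs) =
  all (fun m => all (fun F => ~~ (mnm_supp m \subset F)) Fs) (msupp f).
Proof.
rewrite -[LHS]/(all (fun F => f \in face_ideal K F) Fs).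
apply/allP/allP => /= Fsf t.
  move=> fm; apply/allP => F /Fsf; rewrite in_face_ideal => /allP.
  exact.
move=> FsF; rewrite in_face_ideal; apply/allP => m /Fsf/allP; exact.
Qed.

Lemma mpolyX_in_face_ideal F m :
  ('X_[m] \in face_ideal K F) = ~~ (mnm_supp m \subset F).
Proof. by rewrite in_face_ideal msuppX /= andbT. Qed.

Lemma mcoeff_sum_filter (p : pred 'X_{1..n}) f m :
  (\sum_(k <- msupp f | p k) f@_k *: 'X_[k])@_m = if p m then f@_m else 0.
Proof.
rewrite raddf_sum big_mkcond /=.
have [fm|] := boolP (m \in msupp f).
  rewrite (bigD1_seq m) //= big1 => [|k /negPf km].
    by rewrite mcoeffZ mcoeffX eqxx mulr1 addr0.
  by case: ifP => //; rewrite mcoeffZ mcoeffX km mulr0.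
rewrite -mcoeff_eq0 => fm0; rewrite (eqP fm0) if_same big_seq.
rewrite big1 // => k.
rewrite mcoeff_msupp => fk; case: ifP => // _; rewrite mcoeffZ mcoeffX.
by case: (eqVneq k m) fk => [->|_ _]; rewrite ?fm0 ?mulr0.
Qed.

(** Setting the variables outside F to 0 keeps exactly the monomials supported on F. As the kernel
    of a ring morphism into a domain, P_F is prime. *)
Lemma face_ideal_ker F f :
  (f \in face_ideal K F) =
  (f \mPo [tuple if i \in F then 'X_i : S else 0 | i < n] == 0).
Proof.
have restrX m : 'X_[m] \mPo [tuple if i \in F then 'X_i : S else 0 | i < n]
    = if mnm_supp m \subset F then 'X_[m] else 0.
  rewrite comp_mpolyX; case: ifPn => [/subsetP smF|/subsetPn [j]].
    rewrite mpolyXE_id; apply: eq_bigr => i _; rewrite tnth_mktuple.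
    case: ifPn => // Fi; have := contra (smF i) Fi.
    by rewrite inE negbK => /eqP ->; rewrite !expr0.
  rewrite inE => mj Fj; rewrite (bigD1 j) //= tnth_mktuple (negPf Fj).
  by rewrite expr0n (negPf mj) mul0r.
rewrite comp_mpolyEX (eq_bigr (fun m => if mnm_supp m \subset F
  then f@_m *: 'X_[m] else 0)) => [|m _]; last first.
  by rewrite restrX; case: ifP => // _; rewrite scaler0.
rewrite -big_mkcond in_face_ideal; apply/allP/eqP => [fF|f0 m].
  by rewrite big_seq_cond big1 // => m /andP[/fF/negPf ->].
have := mcoeff_sum_filter (fun m => mnm_supp m \subset F) f m.
rewrite f0 mcoeff0 mcoeff_msupp; case: ifP => // _ <-.
by rewrite eqxx.
Qed.

Lemma prime_face_ideal F : prime_ideal (face_ideal K F).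
Proof.
split; first by rewrite face_ideal_ker rmorph1 oner_eq0.
by move=> f g; rewrite !face_ideal_ker rmorphM mulf_eq0.
Qed.

(** P_F is prime and does not contain x_A; thus multiplication by x_A is injective modulo P_F. *)
Lemma mulX_in_face_ideal A F f : A \subset F ->
  (('X_[mnm_set A] * f : S) \in face_ideal K F) = (f \in face_ideal K F).
Proof.
move=> sAF; rewrite face_ideal_ker.
rewrite rmorphM mulf_eq0 -!face_ideal_ker.
by rewrite mpolyX_in_face_ideal mnm_supp_set sAF.
Qed.

(* g is the quotient by x_A of the part of f supported on F.                  *)
Lemma face_ideal_div A F f :
  (forall m, m \in msupp f -> mnm_supp m \subset F -> A \subset mnm_supp m) ->
  exists2 g : S, 'X_[mnm_set A] * g - f \in face_ideal K F &
    forall d, ring_components K n d f -> ring_components K n (d - #|A|%:Z) g.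
Proof.
move=> fA.
exists (\sum_(m <- msupp f | mnm_supp m \subset F) f@_m *: 'X_[m - mnm_set A]).
  rewrite in_face_ideal; apply/allP => m; apply: contraL => smF.
  rewrite mulr_sumr big_seq_cond.
  rewrite (eq_bigr (fun m => f@_m *: 'X_[m])) => [|k /andP[fk skF]].
    rewrite -big_seq_cond -mcoeff_eq0 mcoeffB mcoeff_sum_filter smF.
    by rewrite subrr.
  rewrite -scalerAr -mpolyXD; congr (_ *: 'X_[_]).
  by rewrite addmC submK // mnm_set_le fA.
move=> d /ring_componentsP df; apply/ring_componentsP => m.
move=> /msupp_sum_le/flattenP [_ /mapP [k + ->]].
rewrite mem_filter => /andP[skF fk] /msuppZ_le; rewrite msuppX inE => /eqP ->.
rewrite -(df k fk) -mdeg_mnm_set -[in RHS](@submK _ (mnm_set A) k).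
  by rewrite mdegD PoszD addrK.
by rewrite mnm_set_le fA.
Qed.

End MonomialIdeals.

(** * Multiplication by x_A as an isomorphism onto a filtration quotient *)

Section FacetIso.
Variables (K : fieldType) (n : nat).
Local Notation S := {mpoly K[n]}.
Local Notation gS := (ring_components K n).
Variables (I J J' : submodClosed S^o) (A F : {set 'I_n}).
Hypotheses (homI : homog_submod gS I) (homJ : homog_submod gS J).
Hypotheses (homJ' : homog_submod gS J') (sIJ' : {subset I <= J'}).
Hypothesis in_J' : forall f : S,
  (f \in J') = (f \in J) && (f \in face_ideal K F).
Hypotheses (sAF : A \subset F) (JA : ('X_[mnm_set A] : S) \in J).
Hypothesis J_A : forall f : S, f \in J ->
  forall m, m \in msupp f -> mnm_supp m \subset F -> A \subset mnm_supp m.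

Let sJ'J : {subset J' <= J}.
Proof. by move=> f; rewrite in_J' => /andP[]. Qed.

Let sIJ : {subset I <= J}.
Proof. by move=> f /sIJ'/sJ'J. Qed.

Let Jmul (s : S) : (('X_[mnm_set A] * s : S) \in J).
Proof. by rewrite mulrC; apply: (rpredZ s). Qed.

Let liftJ (f : S) (Jf : f \in J) : submod (quot_submod I J) :=
  Sub (lproj I f) (etrans (mem_quot_submod (f : S^o) sIJ) Jf).

Let projJ (f : S) (Jf : f \in J) :
    subquot (quot_submod I J) (quot_submod I J') :=
  lproj (restr_submod (quot_submod I J) (quot_submod I J')) (liftJ Jf).

(** Since I is contained in J', the quotient (J / I) / (J' / I) can be handled as J / J'. *)
Let projJ_eq f g (Jf : f \in J) (Jg : g \in J) :
  (projJ Jf == projJ Jg) = (f - g \in J').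
Proof.
rewrite /projJ lproj_eq in_restr_submod raddfB /= -linearB.
by rewrite mem_quot_submod.
Qed.

Let projJ_surj (x : subquot (quot_submod I J) (quot_submod I J')) :
  exists f (Jf : f \in J), x = projJ Jf.
Proof.
have [[_ /[dup] /asboolP [f Jf ->] JIf] ->] := lproj_surj x.
by exists f, Jf; congr lproj; apply: val_inj.
Qed.

Let projJ_components d x :
  subquot_components (quot_components gS I) (quot_submod I J)
    (quot_submod I J') d x <->
  exists f (Jf : f \in J), gS d f /\ x = projJ Jf.
Proof.
split=> [[[u Ju] [f df /= def_u] ->]|[f [Jf [df ->]]]].
  have Jf : f \in J by rewrite -(mem_quot_submod f sIJ) -def_u.
  by exists f, Jf; split=> //; congr lproj; apply: val_inj.
by exists (liftJ Jf) => //; exists f.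
Qed.

Let mulA (s : S^o) := projJ (Jmul s).

Let mulA_linear : linear mulA.
Proof.
move=> c x y; rewrite /mulA /projJ -linearP; congr lproj; apply: val_inj.
rewrite linearP /= -linearP; congr (lproj I _).
by rewrite mulrDr scalerAr.
Qed.

(** In the application I is I_Delta, J and J' are the intersections before and after adding the
    facet F, and A is the restriction set of F. The map s -> x_A s from S to J / J' has kernel P_F
    by [mulX_in_face_ideal] and is onto by [face_ideal_div]; [lquot_lift] supplies the inverse of
    the induced isomorphism. *)
Lemma facet_graded_isomorphic :
  graded_isomorphic
    (subquot_components (quot_components gS I) (quot_submod I J)
       (quot_submod I J'))
    (twist (quot_components gS (face_ideal K F)) (- #|A|%:Z)).
Proof.
have homP : homog_submod gS (face_ideal K F).
  exact: (homog_monomial_ideal (@in_face_ideal K n F)).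
have gradS := ring_grading K n.
split; first apply: subquot_grading.
- exact: quot_grading.
- exact: homog_quot_submod.
- exact: homog_quot_submod.
- by apply: twist_grading; apply: quot_grading.
pose mulAL := GRing.isLinear.Build _ _ _ _ mulA mulA_linear.
pose g : {linear S^o -> _} := HB.pack mulA mulAL.
have kerg (x : S^o) : (g x == 0) = (x \in face_ideal K F).
  rewrite -(linear0 g) /= /mulA projJ_eq mulr0 subr0 in_J' Jmul.
  exact: mulX_in_face_ideal.
(* The difference x_A s - f lies in P_F and also in J, hence in J', so f and x_A s have the same
   class. *)
have divA f (Jf : f \in J) : exists s : S, g s = projJ Jf /\
    forall d, gS d f -> gS (d - #|A|%:Z) s.
  have [s Ps ds] := face_ideal_div (J_A Jf).
  exists s; split=> //; apply/eqP; rewrite /= /mulA projJ_eq in_J' Ps andbT.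
  have [_ subJ] := GRing.submod_closedB (submodClosedP J).
  exact: (subJ _ _ (Jmul s) Jf).
have [y|phi [bij_phi phig]] := lquot_lift kerg.
  by have [f [Jf ->]] := projJ_surj y; have [s []] := divA f Jf; exists s.
exists phi; split=> // d x; rewrite /twist addrC; split.
  case/projJ_components => f [Jf [df ->]].
  have [s [<- ds]] := divA f Jf.
  by exists s; [apply: ds | rewrite phig].
(* Conversely, if [phi x] is the class of s of degree d - #|A|, then x is the class of x_A s, of
   degree d. *)
case=> s ds; rewrite -phig => /(bij_inj bij_phi) ->.
apply/projJ_components; exists ('X_[mnm_set A] * s), (Jmul s); split=> //.
have XA : gS #|A| 'X_[mnm_set A].
  by apply/ring_componentsP => m; rewrite msuppX inE => /eqP ->;
     rewrite mdeg_mnm_set.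
by have := gradingZ gradS XA ds; rewrite subrKC.
Qed.

End FacetIso.

(** * Facets, shellings and restriction sets *)

Section Facets.
Variables (n : nat) (D : {set {set 'I_n}}).
Implicit Types A F G : {set 'I_n}.

Lemma facet_above A : A \in D -> exists2 F, F \in facets D & A \subset F.
Proof.
case/(@maxset_exists _ [in D]) => F /maxsetP [DF maxF] sAF; exists F => //.
rewrite inE DF; apply/forall_inP => G DG; apply/implyP => sFG.
by rewrite (maxF G).
Qed.

Lemma facet_sub F : F \in facets D -> F \in D.
Proof. by rewrite inE => /andP[]. Qed.

Lemma facet_max F G : F \in facets D -> G \in D -> F \subset G -> F = G.
Proof.
rewrite inE => /andP[_ /forall_inP maxF] DG sFG.
by apply/eqP/(implyP (maxF G DG)).
Qed.

Lemma simplicial_complexP :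
  reflect (forall F A, F \in D -> A \subset F -> A \in D)
    (simplicial_complex D).
Proof.
apply: (iffP 'forall_implyP) => simD F.
  by move=> A DF; have /forallP/(_ A)/implyP := simD F DF.
by move=> DF; apply/forallP => A; apply/implyP; apply: simD.
Qed.

End Facets.

Section Complexes.
Variables (n : nat) (Delta : {set {set 'I_n}}).
Hypothesis simDelta : simplicial_complex Delta.
Implicit Types A F G : {set 'I_n}.

Lemma in_subcomplex_gen (Gs : seq {set 'I_n}) A : {subset Gs <= Delta} ->
  (A \in subcomplex_gen Delta Gs) = has (fun G => A \subset G) Gs.
Proof.
move=> sGD; apply/bigcapP/hasP => [DA|[G GsG sAG] D /and3P[simD _ /allP GsD]].
  (* The faces of the members of [Gs] form one of the complexes being intersected. *)
  have := DA [set B : {set 'I_n} | has (fun G => B \subset G) Gs].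
  rewrite inE => /(_ _)/hasP.
  apply; apply/and3P; split.
  - apply/simplicial_complexP => F B; rewrite !inE => /hasP [G GsG sFG] sBF.
    by apply/hasP; exists G => //; apply: subset_trans sFG.
  - apply/subsetP => B; rewrite inE => /hasP [G /sGD DG sBG].
    exact: (simplicial_complexP _ simDelta) DG sBG.
  - by apply/allP => G GsG; rewrite inE; apply/hasP; exists G.
exact: (simplicial_complexP _ simD) (GsD G GsG) sAG.
Qed.

Lemma in_facets_cover (Fs : seq {set 'I_n}) A : Fs =i facets Delta ->
  (A \in Delta) = has (fun F => A \subset F) Fs.
Proof.
move=> FsE; apply/idP/hasP => [/facet_above [F DF sAF]|[F]].
  by exists F; rewrite ?FsE.
rewrite FsE => /facet_sub DF; exact: (simplicial_complexP _ simDelta) DF.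
Qed.

Section Shelling.
Variables (Fs : seq {set 'I_n}) (shDelta : is_shelling Delta Fs).
Variables (k : nat) (k_range : (0 < k <= size Fs)%N).
Local Notation F := (nth_facet Fs k).

(* Bjoerner and Wachs' restriction R(F_k): the faces of F_k lying in no       *)
(* earlier facet are exactly those containing R(F_k).                         *)
Definition facet_restriction : {set 'I_n} :=
  [set v in F | has (fun G => F :\ v \subset G) (take k.-1 Fs)].

Let Fs_facets : Fs =i facets Delta. Proof. by case: shDelta. Qed.

Let k_lt : (k.-1 < size Fs)%N.
Proof. by case: k k_range. Qed.

Lemma nth_facet_facets : F \in facets Delta.
Proof. by rewrite -Fs_facets mem_nth. Qed.

Lemma facet_restriction_sub : facet_restriction \subset F.
Proof. by apply/subsetP => v; rewrite inE => /andP[]. Qed.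

Lemma nth_facet_not_sub G : G \in take k.-1 Fs -> ~~ (F \subset G).
Proof.
move=> eG; apply/negP => sFG.
have DG : G \in Delta by apply: facet_sub; rewrite -Fs_facets (mem_take eG).
have := facet_max nth_facet_facets DG sFG => eqFG.
have [uFs _ _] := shDelta.
have : uniq (take k.-1 Fs ++ [:: F]).
  by rewrite cats1 -take_nth // take_uniq.
by rewrite cats1 rcons_uniq eqFG eG.
Qed.

Lemma in_shelling_meet A : (A \in shelling_meet Delta Fs k) =
  (A \subset F) && has (fun G => A \subset G) (take k.-1 Fs).
Proof.
rewrite inE !in_subcomplex_gen; last 2 first.
- by move=> G; rewrite inE => /eqP ->; apply/facet_sub/nth_facet_facets.
- by move=> G /mem_take; rewrite Fs_facets => /facet_sub.
by rewrite /= orbF andbC.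
Qed.

(** The shelling condition gives every facet of the meet the form F \ v, and lying in the meet puts
    v in the restriction set. Conversely, a larger face of F than F \ v would be F itself, which no
    earlier facet contains. *)
Lemma facets_shelling_meet :
  facets (shelling_meet Delta Fs k) = [set F :\ v | v in facet_restriction].
Proof.
apply/setP => A; apply/idP/imsetP => [fA|[v]].
  have /[!inE] /andP[] := fA; rewrite -in_setI.
  rewrite in_shelling_meet => /andP[sAF eA] _.
  (* The shelling condition starts at 2; for k = 1 there is no earlier facet and the meet is
     empty. *)
  have k2 : (2 <= k <= size Fs)%N.
    case/andP: k_range => k0 ->; rewrite andbT ltn_neqAle k0 andbT.
    by apply: contraTneq eA => <-; rewrite take0.
  have [_ _ /(_ k k2 A fA) [v Fv def_A]] := shDelta.
  by exists v; rewrite // inE Fv -def_A.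
rewrite inE => /andP[Fv eFv] ->; rewrite inE in_shelling_meet subD1set eFv.
apply/forall_inP => G; rewrite in_shelling_meet.
move=> /andP[sGF /hasP[G' eG' sGG']].
apply/implyP => sFG; rewrite eqEsubset sFG subsetD1 sGF.
apply: contra (nth_facet_not_sub eG') => Gv; apply: subset_trans sGG'.
by rewrite -(setD1K Fv) subUset sub1set Gv.
Qed.

(** Removing a vertex is injective on the vertices of F; for k = 1 the restriction set is empty, in
    agreement with a_1 = 0. *)
Lemma card_facet_restriction :
  #|facet_restriction| = shelling_number Delta Fs k.
Proof.
rewrite /shelling_number; case: ifP => [k1|_].
  apply: eq_card0 => v; rewrite !inE.
  by move: k1 k_range; case: k => [|[|]] //=; rewrite take0 andbF.
rewrite facets_shelling_meet card_in_imset // => u v.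
rewrite !inE => /andP[Fu _] /andP[Fv _] /setP /(_ u).
by rewrite !inE eqxx Fu andbT; case: eqP.
Qed.

(** The face F cap G of the meet lies in a facet F \ v of it, with v in the restriction set; then v
    is not in G. *)
Lemma facet_restriction_not_sub G : G \in take k.-1 Fs ->
  ~~ (facet_restriction \subset G).
Proof.
move=> eG; have meetFG : F :&: G \in shelling_meet Delta Fs k.
  by rewrite in_shelling_meet subsetIl; apply/hasP; exists G; rewrite ?subsetIr.
have [A] := facet_above meetFG.
rewrite facets_shelling_meet => /imsetP [v Rv ->] sFGv.
apply/subsetPn; exists v => //; apply: contraTN Rv => Gv; rewrite inE.
have := subsetP sFGv v; rewrite !inE eqxx Gv andbT => notF.
by apply/negP => /andP[/notF].
Qed.

End Shelling.
End Complexes.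

(** * The support of S / I and its minimal primes *)

Section Support.
Variables (R : comNzRingType) (I P : submodClosed R^o).

(** An element of I outside P kills all of R / I and so annihilates the localization; if I lies in
    P, the fraction 1/1 is nonzero. *)
Lemma in_supp_quot : in_supp (lquot I) P <-> prime_ideal P /\ {subset I <= P}.
Proof.
split=> [[primeP [m [s [_ m_neq0]]]]|[primeP sIP]]; split=> //.
  move=> x Ix; have [//|Px] := boolP (x \in P); case: m_neq0; exists x => //.
  have [y ->] := lproj_surj m; rewrite scaler0 subr0 scale1r -linearZ /=.
  by apply/eqP; rewrite lproj_eq0 -[_ *: _]/(x * y) mulrC; apply: (rpredZ y).
exists (lproj I 1), 1; split; first by case: primeP.
case=> u /negP Pu; rewrite scaler0 subr0 scale1r -linearZ => /eqP.
by rewrite lproj_eq0 -[_ *: _]/(u * 1) mulr1 => /sIP.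
Qed.

End Support.

Section FacetPrimes.
Variables (K : fieldType) (n : nat) (Delta : {set {set 'I_n}}).
Hypothesis simDelta : simplicial_complex Delta.
Local Notation S := {mpoly K[n]}.

Lemma SR_ideal_sub_face F : F \in Delta ->
  {subset SR_ideal K Delta <= face_ideal K F}.
Proof.
move=> DF f; rewrite in_face_ideal in_SR_ideal //; apply: sub_all => m.
by apply: contra => /(simplicial_complexP _ simDelta)->.
Qed.

(* For j outside a facet F, the monomial x_j x_F lies in I_Delta, hence in    *)
(* every prime of the support, while x_F does not lie in P_F.                 *)
Lemma facet_min_prime_supp F : F \in facets Delta ->
  min_prime_supp (SR_module K Delta) (face_ideal K F).
Proof.
move=> facF; have DF := facet_sub facF; split.
  apply/in_supp_quot; split; first exact: prime_face_ideal.
  exact: SR_ideal_sub_face.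
move=> P /in_supp_quot [[_ primeP] sIP] sPF f; apply/idP/idP => [/sPF //|].
rewrite in_face_ideal => /allP fF; rewrite [f]mpolyE big_seq.
apply: rpred_sum => m /fF /subsetPn [j mj Fj].
have /submK <- : (mnm_set [set j] <= m)%MM by rewrite mnm_set_le sub1set.
rewrite mpolyXD scalerAl; apply: (rpredZ (_ *: _ : S)).
have : 'X_[mnm_set F] * 'X_[mnm_set [set j]] \in (P : {pred S}).
  apply: sIP; rewrite -mpolyXD in_SR_ideal // msuppX /= andbT mnm_suppD.
  rewrite !mnm_supp_set; apply: contra Fj => DFj.
  by rewrite (facet_max facF DFj (subsetUl _ _)) !inE eqxx orbT.
case/primeP/orP => // /sPF.
by rewrite mpolyX_in_face_ideal mnm_supp_set subxx.
Qed.

End FacetPrimes.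

Theorem proposition8p2 (K : fieldType) (n : nat) (Delta : {set {set 'I_n}})
    (Fs : seq {set 'I_n})
    (hDelta : simplicial_complex Delta) (hFs : is_shelling Delta Fs) :
  let r := size Fs in
  let M := SR_filtration K Delta Fs in
  let a := shelling_number Delta Fs in
  clean_filtration r M /\
  forall i, (0 < i <= r)%N ->
    let k := (r - i).+1 in
    let P := face_ideal K (nth_facet Fs k) in
    min_prime_supp (SR_module K Delta) P /\
    graded_isomorphic
      (subquot_components
         (quot_components (ring_components K n) (SR_ideal K Delta))
         (M i) (M i.-1))
      (twist (quot_components (ring_components K n) P) (- (a k)%:Z)).
Proof.
move=> r M a; have [_ FsE _] := hFs.
have sIcap k : {subset SR_ideal K Delta <= seq_cap (face_ideal K) (take k Fs)}.
  move=> f If; apply/allP => F /mem_take; rewrite FsE => /facet_sub DF.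
  exact: SR_ideal_sub_face If.
(* A set is a face exactly when some facet contains it; this will give M_0 = 0. *)
have inSR : seq_cap (face_ideal K) Fs =i SR_ideal K Delta.
  move=> f; rewrite in_cap_face_ideal in_SR_ideal //; apply: eq_all => m /=.
  by rewrite (in_facets_cover hDelta _ FsE) -all_predC.
(* The graded statement comes first: forgetting degrees in it gives the last clause of cleanness. *)
set Q := (X in _ /\ X); have quotients : Q.
  move=> i /andP[i0 ir] k P.
  have k_range : (0 < k <= size Fs)%N.
    by rewrite /k /= ltn_subrL i0 (leq_trans i0 ir).
  have predk : (r - i.-1)%N = k.
    by rewrite -subn1 subnBA // addn1 subSn.
  split; first exact/facet_min_prime_supp/(nth_facet_facets hFs k_range).
  rewrite /a -(card_facet_restriction hDelta hFs k_range).
  rewrite /M /SR_filtration predk.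
  have homcap k' := homog_monomial_ideal (@in_cap_face_ideal K n (take k' Fs)).
  apply: facet_graded_isomorphic => //.
  - exact: (homog_monomial_ideal (fun f => in_SR_ideal f hDelta)).
  - exact: homcap.
  - exact: homcap.
  - exact: sIcap.
  (* Adding F_k to the first k - 1 facets intersects the ideal with P_(F_k). *)
  - move=> f; rewrite /k (take_nth set0) ; last by case/andP: k_range.
    by rewrite -[LHS]/(all _ _) all_rcons andbC.
  - exact: facet_restriction_sub.
  - rewrite in_cap_face_ideal msuppX /= andbT mnm_supp_set; apply/allP => G.
    exact: (facet_restriction_not_sub hDelta hFs k_range).
  (* If the support of m lay in F_k but missed a v in the restriction set, it would lie in F_k \ v,
     hence in an earlier facet G, although f is in P_G. *)
  move=> f; rewrite in_cap_face_ideal => /allP capf m /capf/allP notG smF.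
  apply/subsetP => v; rewrite inE => /andP[Fv /hasP [G eG sFG]].
  have := notG G eG; apply: contraR => mv; apply: subset_trans sFG.
  by rewrite subsetD1 smF.
split=> //; split.
- move=> x; have [f ->] := lproj_surj x.
  rewrite (mem_quot_submod _ (@sIcap _)) subn0 take_size.
  by rewrite inSR inE lproj_eq0.
- move=> x; have [f ->] := lproj_surj x.
  by rewrite (mem_quot_submod _ (@sIcap _)) subnn take0.
- move=> i _ x; have [f ->] := lproj_surj x.
  rewrite !(mem_quot_submod _ (@sIcap _)) !in_seq_cap.
  move=> /allP capf; apply/allP => F eF; apply: capf.
  have le_i : (size Fs - i <= size Fs - i.-1)%N by rewrite leq_sub2l ?leq_pred.
  by rewrite -(subnKC le_i) takeD mem_cat eF.
move=> i /quotients [minP [_ _ [phi [bij_phi _]]]].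
by exists (face_ideal K (nth_facet Fs (r - i).+1)) => //; exists phi.
Qed.
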